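(* Consider the four-node network with the setting described in the context. Under serial network and channel decoding at node 4, the achievable rate region $\Lambda_{\text{serial}}$ is the convex hull of all rate pairs $(R_A,R_B)$ satisfying $$R_A \le \mathbb{C}_{1,4}, \qquad R_B \le \mathbb{C}',$$ where $\mathbb{C}_{1,4}=1-H(p_{1,4})$ and $\mathbb{C}'=1-H(p')$ is the capacity of a binary symmetric channel with crossover probability $$p' = [(1-p_{1,3})(1-p_{2,3})+p_{1,3}p_{2,3}]\,p_{3,4} + [p_{1,3}(1-p_{2,3})+(1-p_{1,3})p_{2,3}](1-p_{3,4}).$$
   Context: Network: nodes $1,2,3,4$ with directed links $1\to3$, $1\to4$, $2\to3$, $3\to4$. Each link $i\to j$ is a binary symmetric channel (BSC) with crossover probability $p_{i,j}$: input $X_{i,j}\in\{0,1\}$, output $Y_{i,j}=X_{i,j}\oplus E_{i,j}$ with $\Pr\{E_{i,j}=1\}=p_{i,j}$; the link channels are independent, time invariant and memoryless. $H(p)=-p\log p-(1-p)\log(1-p)$ is the binary entropy function (base 2), and the capacity of a BSC with crossover $p$ is $1-H(p)$. Messages $A$ and $B$ are independent and uniformly distributed on $\{1,\dots,\lfloor 2^{nR_A}\rfloor\}$ and $\{1,\dots,\lfloor 2^{nR_B}\rfloor\}$, with $n$ the common block length (each link is used $n$ times). Node 1 encodes $A$ with a (linear) channel code into $\mathbf{X}_{1,3}(A)=\mathbf{X}_{1,4}(A)\in\{0,1\}^n$ and sends it on both links $1\to3$ and $1\to4$; node 2 encodes $B$ with a (linear) channel code into $\mathbf{X}_{2,3}(B)\in\{0,1\}^n$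 and sends it on link $2\to3$. Node 3 performs no decoding: it transmits $\mathbf{X}_{3,4}=\mathbf{Y}_{1,3}\oplus\mathbf{Y}_{2,3}$ (bitwise XOR). Node 4 must estimate $(\hat A,\hat B)$ from $\mathbf{Y}_{1,4}$ and $\mathbf{Y}_{3,4}$; a rate pair is achievable if $\Pr\{(\hat A,\hat B)\neq(A,B)\}$ can be made arbitrarily small. Serial decoding: node 4 first decodes $A$ from $\mathbf{Y}_{1,4}$, then reconstructs $\mathbf{X}_{1,3}(\hat A)$, forms $\mathbf{Y}_{3,4}\oplus\mathbf{X}_{1,3}(\hat A)$ and decodes $B$ from it. The achievable rate region of a strategy is the set of rate pairs achievable when node 4 uses that strategy.
   Formalization: The achievable rate region is taken as the closure of the set of achievable rate pairs (pairs exactly at capacity need not be achievable), rates are nonnegative, and the channel codes may be arbitrary rather than linear. *)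

(* Defs.v *)
From HB Require Import structures.
From mathcomp Require Import all_boot all_order all_algebra.
From mathcomp Require Import reals exp.
Set Implicit Arguments. Unset Strict Implicit. Unset Printing Implicit Defensive.
Import Order.TTheory GRing.Theory Num.Theory.
Local Open Scope ring_scope.

Section Defs.
Variable R : realType.

Definition bits (n : nat) := {ffun 'I_n -> bool}.
Definition bxor (n : nat) (x y : bits n) : bits n := [ffun i => x i (+) y i].

(** probability of the error pattern e on n uses of a memoryless BSC(p) *)
Definition bsc_weight (p : R) (n : nat) (e : bits n) : R :=
  \prod_(i < n) (if e i then p else 1 - p).

Definition xlog2 (x : R) : R := if x == 0 then 0 else x * (ln x / ln 2).
Definition Hb (p : R) : R := - xlog2 p - xlog2 (1 - p).
Definition bsc_capacity (p : R) : R := 1 - Hb p.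

Definition num_msgs (n : nat) (r : R) : nat := Num.truncn (powR 2 (n%:R * r)).

(** Block error probability Pr{(Â,B̂) <> (A,B)} of the serial strategy:
    A, B uniform and independent, the four link noises independent BSCs;
    node 3 forwards Y13 xor Y23; node 4 decodes Â := decA Y14, then
    B̂ := decB (Y34 xor X13(Â)). *)
Definition serial_error (p13 p14 p23 p34 : R) (n MA MB : nat)
  (encA : 'I_MA -> bits n) (encB : 'I_MB -> bits n)
  (decA : bits n -> 'I_MA) (decB : bits n -> 'I_MB) : R :=
  ((MA * MB)%:R)^-1 *
  \sum_(a : 'I_MA) \sum_(b : 'I_MB)
   \sum_(e13 : bits n) \sum_(e14 : bits n) \sum_(e23 : bits n) \sum_(e34 : bits n)
     (bsc_weight p13 e13 * bsc_weight p14 e14 * bsc_weight p23 e23 * bsc_weight p34 e34 *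
      (let y14 := bxor (encA a) e14 in
       let y13 := bxor (encA a) e13 in
       let y23 := bxor (encB b) e23 in
       let y34 := bxor (bxor y13 y23) e34 in
       let ah := decA y14 in
       let bh := decB (bxor y34 (encA ah)) in
       if (ah == a) && (bh == b) then 0 else 1)).

Definition serial_achievable (p13 p14 p23 p34 : R) (RA RB : R) : Prop :=
  0 <= RA /\ 0 <= RB /\
  forall eps : R, 0 < eps -> exists N : nat, forall n : nat, (N <= n)%N ->
    exists (encA : 'I_(num_msgs n RA) -> bits n)
           (encB : 'I_(num_msgs n RB) -> bits n)
           (decA : bits n -> 'I_(num_msgs n RA))
           (decB : bits n -> 'I_(num_msgs n RB)),
      serial_error p13 p14 p23 p34 encA encB decA decB <= eps.

(** the serial achievable rate region, taken (as is standard in information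
    theory) as the closure of the set of achievable rate pairs *)
Definition serial_region (p13 p14 p23 p34 : R) (z : R * R) : Prop :=
  forall delta : R, 0 < delta -> exists RA RB : R,
    serial_achievable p13 p14 p23 p34 RA RB /\
    `|RA - fst z| < delta /\ `|RB - snd z| < delta.

Definition conv_hull (S : R * R -> Prop) (z : R * R) : Prop :=
  exists (k : nat) (w : 'I_k -> R) (x : 'I_k -> R * R),
    (forall i, 0 <= w i) /\ \sum_(i < k) w i = 1 /\ (forall i, S (x i)) /\
    z = (\sum_(i < k) w i * (x i).1, \sum_(i < k) w i * (x i).2).

Definition p_eff (p13 p23 p34 : R) : R :=
  ((1 - p13) * (1 - p23) + p13 * p23) * p34 +
  (p13 * (1 - p23) + (1 - p13) * p23) * (1 - p34).

End Defs.

(* Main.v *)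
(* Once node 4 has decoded A correctly, cancelling X13(A) leaves the codeword of B
   corrupted by e13 + e23 + e34, which is BSC(p') noise independent of the noise e14
   on which the decoding of A depends.  Hence the probability of success is exactly the
   product of the success probabilities of two point-to-point codes, over BSC(p14)
   and BSC(p'), and the region is the box given by their capacities.  The channel
   coding theorem for a BSC rests on Chebyshev's inequality for the information
   - ln Pr(e) of a noise word: for the converse, correctly decoded typical noise has
   total mass at most 2^n exp(-n(h - t)) / M; for achievability, averaging over all
   codebooks bounds the collisions of a typical-set decoder. *)

Require Import Defs.
From HB Require Import structures.
From mathcomp Require Import all_boot all_order all_algebra.
From mathcomp Require Import reals sequences exp.
From mathcomp Require Import ring lra.
Import Order.TTheory GRing.Theory Num.Theory.
Local Open Scope ring_scope.
Set Implicit Arguments. Unset Strict Implicit. Unset Printing Implicit Defensive.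

(** * Binary words under XOR *)

Lemma bxorC n (x y : bits n) : bxor x y = bxor y x.
Proof. by apply/ffunP=> i; rewrite !ffunE addbC. Qed.

Lemma bxorA n (x y z : bits n) : bxor x (bxor y z) = bxor (bxor x y) z.
Proof. by apply/ffunP=> i; rewrite !ffunE addbA. Qed.

Lemma bxorK n (x y : bits n) : bxor (bxor x y) y = x.
Proof. by apply/ffunP=> i; rewrite !ffunE addbK. Qed.

Lemma bxorKl n (x y : bits n) : bxor x (bxor x y) = y.
Proof. by rewrite bxorC (bxorC x) bxorK. Qed.

Lemma reindex_bxor (V : nmodType) n (x : bits n) (F : bits n -> V) :
  \sum_y F y = \sum_y F (bxor x y).
Proof.
by apply: reindex; apply: onW_bij; exists (bxor x) => y; exact: bxorKl.
Qed.

(** * Noise of a memoryless BSC as a product distribution *)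

Section BSC.
Variable R : realType.
Implicit Types (p q t eps r : R) (n M : nat).

Definition bit_weight p (b : bool) : R := if b then p else 1 - p.

Lemma sum_bit_weight p (F : bool -> R) :
  \sum_b bit_weight p b * F b = p * F true + (1 - p) * F false.
Proof. by rewrite big_bool. Qed.

Lemma bit_weight_ge0 p b : 0 <= p <= 1 -> 0 <= bit_weight p b.
Proof. by case: b => /= ?; lra. Qed.

Lemma bsc_weightE p n (e : bits n) : bsc_weight p e = \prod_i bit_weight p (e i).
Proof. by []. Qed.

Lemma bsc_weight_ge0 p n (e : bits n) : 0 <= p <= 1 -> 0 <= bsc_weight p e.
Proof. by move=> hp; apply: prodr_ge0 => i _; exact: bit_weight_ge0. Qed.

(** Independence of the channel uses, by distributing the product over the sums: it reduces
    expectations over noise words to single bits. *)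
Lemma sum_bsc_weight_prod p n (F : 'I_n -> bool -> R) :
  \sum_(e : bits n) bsc_weight p e * \prod_i F i (e i) =
  \prod_i \sum_b bit_weight p b * F i b.
Proof.
rewrite bigA_distr_bigA; apply: eq_bigr => e _.
by rewrite big_split.
Qed.

Lemma sum_bsc_weight p n : \sum_(e : bits n) bsc_weight p e = 1.
Proof.
transitivity (\sum_(e : bits n) bsc_weight p e * \prod_(i < n) 1).
  by apply: eq_bigr => e _; rewrite big1 // mulr1.
rewrite (sum_bsc_weight_prod p (fun (_ : 'I_n) _ => 1)) big1 // => i _.
by rewrite sum_bit_weight; ring.
Qed.

(** Two BSCs in cascade form a BSC. With z the XOR of the noises held fixed, the sum over the first
    noise factors over positions, each factor being the probability that two independent noise bits
    add up to [z i]. *)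
Lemma bsc_weight_conv p q n (F : bits n -> R) :
  \sum_(e : bits n) \sum_(e' : bits n)
     bsc_weight p e * bsc_weight q e' * F (bxor e e') =
  \sum_(z : bits n) bsc_weight (p * (1 - q) + (1 - p) * q) z * F z.
Proof.
under eq_bigr => e _ do rewrite (reindex_bxor e).
rewrite exchange_big; apply: eq_bigr => z _ /=.
under eq_bigr => e _ do rewrite bxorKl.
rewrite -big_distrl /=; congr (_ * _).
transitivity (\sum_(e : bits n) bsc_weight p e *
                 \prod_i bit_weight q (e i (+) z i)).
  apply: eq_bigr => e _; congr (_ * _); rewrite bsc_weightE.
  by apply: eq_bigr => i _; rewrite ffunE.
rewrite (sum_bsc_weight_prod p (fun i b => bit_weight q (b (+) z i))).
rewrite bsc_weightE.
by apply: eq_bigr => i _; rewrite sum_bit_weight; case: (z i) => /=; ring.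
Qed.

Definition correct_prob p {n M} (enc : 'I_M -> bits n) (dec : bits n -> 'I_M) : R :=
  M%:R^-1 * \sum_m \sum_(e : bits n)
     bsc_weight p e * (dec (bxor (enc m) e) == m)%:R.

Lemma correct_prob_ge0 p n M (enc : 'I_M -> bits n) (dec : bits n -> 'I_M) :
  0 <= p <= 1 -> 0 <= correct_prob p enc dec.
Proof.
move=> hp; apply: mulr_ge0; first by rewrite invr_ge0.
by apply: sumr_ge0 => m _; apply: sumr_ge0 => e _; rewrite mulr_ge0 ?bsc_weight_ge0.
Qed.

Lemma correct_prob_le1 p n M (enc : 'I_M -> bits n) (dec : bits n -> 'I_M) :
  0 <= p <= 1 -> correct_prob p enc dec <= 1.
Proof.
move=> hp; rewrite /correct_prob; case: M enc dec => [|M] enc dec.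
  by rewrite invr0 mul0r.
rewrite ler_pdivrMl ?ltr0Sn // mulr1.
apply: (@le_trans _ _ (\sum_(m < M.+1) 1)); last by rewrite sumr_const card_ord.
apply: ler_sum => m _; rewrite -[leRHS](sum_bsc_weight p n).
apply: ler_sum => e _; apply: ler_piMr; first exact: bsc_weight_ge0.
by case: (_ == _); rewrite ?lexx ?ler01.
Qed.

(** * Factorization of the serial success probability *)

(** Exhibits p' as the cascade of p13 with the cascade of p23 and p34, so that [bsc_weight_conv]
    applies twice. *)
Lemma p_effE p13 p23 p34 : p_eff p13 p23 p34 =
  p13 * (1 - (p23 * (1 - p34) + (1 - p23) * p34)) +
  (1 - p13) * (p23 * (1 - p34) + (1 - p23) * p34).
Proof. by rewrite /p_eff; ring. Qed.

Lemma p_eff_itv p13 p23 p34 : 0 <= p13 <= 1 -> 0 <= p23 <= 1 -> 0 <= p34 <= 1 ->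
  0 <= p_eff p13 p23 p34 <= 1.
Proof.
have conv (x y : R) : 0 <= x <= 1 -> 0 <= y <= 1 -> 0 <= x * (1 - y) + (1 - x) * y <= 1.
  by move=> hx hy; apply/andP; split; nra.
by move=> h1 h2 h3; rewrite p_effE; apply: (conv) => //; exact: conv.
Qed.

(** A wrong estimate of A is already a block error, whatever becomes of B; so only the case where
    the codeword of A cancels has to be analysed for B. *)
Lemma serial_errorE p13 p14 p23 p34 n MA MB
    (encA : 'I_MA -> bits n) (encB : 'I_MB -> bits n)
    (decA : bits n -> 'I_MA) (decB : bits n -> 'I_MB) :
  (0 < MA)%N -> (0 < MB)%N ->
  serial_error p13 p14 p23 p34 encA encB decA decB =
  1 - correct_prob p14 encA decA * correct_prob (p_eff p13 p23 p34) encB decB.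
Proof.
move=> MA0 MB0.
pose cA a := \sum_(e : bits n) bsc_weight p14 e * (decA (bxor (encA a) e) == a)%:R.
pose cB b := \sum_(e : bits n) bsc_weight (p_eff p13 p23 p34) e *
               (decB (bxor (encB b) e) == b)%:R.
have step a b :
   \sum_(e13 : bits n) \sum_(e14 : bits n) \sum_(e23 : bits n) \sum_(e34 : bits n)
     (bsc_weight p13 e13 * bsc_weight p14 e14 * bsc_weight p23 e23 * bsc_weight p34 e34 *
      (let y14 := bxor (encA a) e14 in
       let y13 := bxor (encA a) e13 in
       let y23 := bxor (encB b) e23 in
       let y34 := bxor (bxor y13 y23) e34 in
       let ah := decA y14 in
       let bh := decB (bxor y34 (encA ah)) in
       if (ah == a) && (bh == b) then 0 else 1)) = 1 - cA a * cB b.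
  pose G e := (decB (bxor (encB b) e) == b)%:R : R.
  (* The error indicator is 1 minus the success indicator, and in the success term [e14] separates
     from the other three noises. *)
  have split4 e13 e14 e23 e34 :
     bsc_weight p13 e13 * bsc_weight p14 e14 * bsc_weight p23 e23 * bsc_weight p34 e34 *
      (let y14 := bxor (encA a) e14 in
       let y13 := bxor (encA a) e13 in
       let y23 := bxor (encB b) e23 in
       let y34 := bxor (bxor y13 y23) e34 in
       let ah := decA y14 in
       let bh := decB (bxor y34 (encA ah)) in
       if (ah == a) && (bh == b) then 0 else 1) =
     bsc_weight p13 e13 * (bsc_weight p14 e14 * (bsc_weight p23 e23 * bsc_weight p34 e34)) -
     bsc_weight p14 e14 * (decA (bxor (encA a) e14) == a)%:R *
     (bsc_weight p13 e13 * (bsc_weight p23 e23 * bsc_weight p34 e34 *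
        G (bxor e13 (bxor e23 e34)))).
    rewrite /= /G; case: eqP => [->|_] /=; last by ring.
    have -> : bxor (bxor (bxor (bxor (encA a) e13) (bxor (encB b) e23)) e34) (encA a) =
              bxor (encB b) (bxor e13 (bxor e23 e34)).
      apply/ffunP => i; rewrite !ffunE.
      by case: (encA a i) (e13 i) (encB b i) (e23 i) (e34 i) => [] [] [] [] [].
    by case: eqP => _ /=; ring.
  under eq_bigr => e13 _ do under eq_bigr => e14 _ do under eq_bigr => e23 _ do
    under eq_bigr => e34 _ do rewrite split4.
  have total : \sum_(e13 : bits n) \sum_(e14 : bits n) \sum_(e23 : bits n)
       \sum_(e34 : bits n) bsc_weight p13 e13 *
       (bsc_weight p14 e14 * (bsc_weight p23 e23 * bsc_weight p34 e34)) = 1.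
    rewrite -[RHS](sum_bsc_weight p13 n); apply: eq_bigr => e13 _.
    rewrite -[RHS]mulr1 -[in RHS](sum_bsc_weight p14 n) big_distrr.
    apply: eq_bigr => e14 _ /=; rewrite -[RHS]mulr1 -[in RHS](sum_bsc_weight p23 n) big_distrr.
    apply: eq_bigr => e23 _ /=; rewrite -[RHS]mulr1 -[in RHS](sum_bsc_weight p34 n) big_distrr.
    by apply: eq_bigr => e34 _ /=; ring.
  have cBE : cB b = \sum_(e13 : bits n) \sum_(e23 : bits n) \sum_(e34 : bits n)
       bsc_weight p13 e13 * (bsc_weight p23 e23 * bsc_weight p34 e34 *
          G (bxor e13 (bxor e23 e34))).
    rewrite /cB p_effE -bsc_weight_conv; apply: eq_bigr => e13 _.
    under eq_bigr => e _ do rewrite -mulrA.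
    rewrite -big_distrr /=.
    rewrite -(bsc_weight_conv p23 p34 (fun z => G (bxor e13 z))) big_distrr /=.
    by apply: eq_bigr => e23 _; rewrite big_distrr.
  under eq_bigr => e13 _ do under eq_bigr => e14 _ do under eq_bigr => e23 _ do rewrite sumrB.
  under eq_bigr => e13 _ do under eq_bigr => e14 _ do rewrite sumrB.
  under eq_bigr => e13 _ do rewrite sumrB.
  rewrite sumrB total; congr (_ - _).
  rewrite cBE /cA exchange_big big_distrl /=; apply: eq_bigr => e14 _.
  rewrite big_distrr /=; apply: eq_bigr => e13 _.
  rewrite big_distrr /=; apply: eq_bigr => e23 _.
  by rewrite big_distrr.
rewrite /serial_error.
under eq_bigr => a _ do under eq_bigr => b _ do rewrite step.
under eq_bigr => a _ do rewrite sumrB sumr_const card_ord -big_distrr.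
rewrite sumrB -big_distrl sumr_const card_ord /= /correct_prob -/cA -/cB.
rewrite natrM.
have : MA%:R != 0 :> R by rewrite pnatr_eq0 -lt0n.
have : MB%:R != 0 :> R by rewrite pnatr_eq0 -lt0n.
rewrite -mulrnA mulnC natrM => ? ?.
by field; apply/andP.
Qed.

(** * Information of a noise word and Chebyshev's inequality *)

(** Self-information in nats, hence the factors [ln 2] next to [Hb]. *)
Definition bit_info p b : R := - ln (bit_weight p b).

Definition info p n (e : bits n) : R := \sum_(i < n) bit_info p (e i).

Lemma expRN_info p n (e : bits n) :
  expR (- info p e) = \prod_(i < n) expR (ln (bit_weight p (e i))).
Proof.
rewrite /info -sumrN expR_sum.
by apply: eq_bigr => i _; rewrite opprK.
Qed.

(** A bit of weight 0 lies below any exponential, so the inequality survives p = 0 and p = 1;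
    equality is recovered below for words of nonzero weight. *)
Lemma bsc_weight_le_info p n (e : bits n) : 0 <= p <= 1 ->
  bsc_weight p e <= expR (- info p e).
Proof.
move=> hp; rewrite expRN_info; apply: ler_prod => i _.
rewrite -/(bit_weight p (e i)) bit_weight_ge0 //=.
have := bit_weight_ge0 (e i) hp; rewrite le_eqVlt => /predU1P[<-|w0].
  exact: expR_ge0.
by rewrite lnK.
Qed.

Lemma bsc_weight_info p n (e : bits n) : 0 <= p <= 1 -> bsc_weight p e != 0 ->
  bsc_weight p e = expR (- info p e).
Proof.
move=> hp; rewrite expRN_info bsc_weightE prodf_seq_neq0 => /allP w_neq0.
apply: eq_bigr => i _; rewrite lnK // posrE lt_neqAle bit_weight_ge0 // andbT.
by rewrite eq_sym; apply: w_neq0; rewrite mem_index_enum.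
Qed.

Lemma ln2_gt0 : 0 < ln 2 :> R.
Proof. by apply: ln_gt0; lra. Qed.

Lemma mean_bit_info p : \sum_b bit_weight p b * bit_info p b = ln 2 * Hb p.
Proof.
have xlog (x : R) : ln 2 * xlog2 x = x * ln x.
  rewrite /xlog2; case: eqP => [->|_]; first by rewrite mulr0 mul0r.
  by have l2 := ln2_gt0; field; lra.
by rewrite sum_bit_weight /bit_info /= /Hb mulrBr !mulrN !xlog.
Qed.

(** Variance of a sum of independent centred terms: the cross terms vanish. *)
Lemma bsc_variance p n (g : bool -> R) :
  \sum_b bit_weight p b * g b = 0 ->
  \sum_(e : bits n) bsc_weight p e * (\sum_i g (e i)) ^+ 2 =
  n%:R * \sum_b bit_weight p b * g b ^+ 2.
Proof.
move=> g0.
(* Padding with 1 writes g at position i as a product over all positions, the form required by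
   [sum_bsc_weight_prod]. *)
pose c (i k : 'I_n) b := if k == i then g b else 1.
have prod_c (i : 'I_n) (e : bits n) : \prod_k c i k (e k) = g (e i).
  rewrite (bigD1 i) //= /c eqxx big1 ?mulr1 // => k /negbTE ki.
  by rewrite ki.
transitivity (\sum_i \sum_j \sum_(e : bits n)
    bsc_weight p e * \prod_k (c i k (e k) * c j k (e k))).
  under eq_bigr => e _ do rewrite expr2 big_distrlr big_distrr /=.
  rewrite exchange_big; apply: eq_bigr => i _ /=.
  under eq_bigr => e _ do rewrite big_distrr /=.
  rewrite exchange_big; apply: eq_bigr => j _ /=.
  by apply: eq_bigr => e _; rewrite big_split /= !prod_c.
transitivity (\sum_(i < n) \sum_b bit_weight p b * g b ^+ 2); last first.
  by rewrite sumr_const card_ord mulr_natl.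
(* For j distinct from i the factor at position i is the mean of g, which is 0. *)
apply: eq_bigr => i _; rewrite (bigD1 i) //= [X in _ + X]big1 ?addr0; last first.
  move=> j ji; rewrite (sum_bsc_weight_prod p (fun k b => c i k b * c j k b)).
  rewrite (bigD1 i) //= /c eqxx eq_sym (negbTE ji).
  by under eq_bigr => b _ do rewrite mulr1; rewrite g0 mul0r.
rewrite (sum_bsc_weight_prod p (fun k b => c i k b * c i k b)).
rewrite (bigD1 i) //= [X in _ * X]big1 ?mulr1.
  by apply: eq_bigr => b _; rewrite /c eqxx expr2.
move=> k /negbTE ki; rewrite /c ki sum_bit_weight; ring.
Qed.

Definition info_var p : R :=
  \sum_b bit_weight p b * (bit_info p b - ln 2 * Hb p) ^+ 2.

Lemma info_var_ge0 p : 0 <= p <= 1 -> 0 <= info_var p.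
Proof.
by move=> hp; apply: sumr_ge0 => b _; rewrite mulr_ge0 ?bit_weight_ge0 ?sqr_ge0.
Qed.

Lemma info_chebyshev p n t : 0 <= p <= 1 -> (0 < n)%N -> 0 < t ->
  \sum_(e : bits n) bsc_weight p e *
     (n%:R * t < `|info p e - n%:R * (ln 2 * Hb p)|)%R%:R <=
  info_var p / (n%:R * t ^+ 2).
Proof.
move=> hp n0 t0; have n0' : 0 < n%:R :> R by rewrite ltr0n.
have nt0 : 0 < n%:R * t by rewrite mulr_gt0.
pose g b := bit_info p b - ln 2 * Hb p.
have g0 : \sum_b bit_weight p b * g b = 0.
  under eq_bigr => b _ do rewrite mulrBr.
  by rewrite sumrB mean_bit_info sum_bit_weight; ring.
have infoE (e : bits n) : info p e - n%:R * (ln 2 * Hb p) = \sum_i g (e i).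
  by rewrite sumrB sumr_const card_ord mulr_natl.
have -> : info_var p / (n%:R * t ^+ 2) =
    (n%:R * t) ^- 2 * (n%:R * \sum_b bit_weight p b * g b ^+ 2).
  by rewrite -/(info_var p); field; lra.
(* Termwise, the indicator of |s| > n t is at most s^2 / (n t)^2. *)
rewrite -(bsc_variance n g0) big_distrr /=; apply: ler_sum => e _.
rewrite infoE mulrCA ler_wpM2l ?bsc_weight_ge0 //.
set s := \sum_i _; case: ltP => hs /=; last first.
  by rewrite mulr_ge0 ?invr_ge0 ?sqr_ge0.
rewrite ler_pdivlMl ?exprn_gt0 // mulr1 -(real_normK (num_real s)).
by apply: lerXn2r; rewrite ?nnegrE ?normr_ge0 // ltW.
Qed.

(** * Upper bound on the success probability of any code *)

Lemma card_bits n : #|{: bits n}| = (2 ^ n)%N.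
Proof. by rewrite card_ffun card_bool card_ord. Qed.

(** Decoding regions partition the received words: each of the 2^n words is counted for exactly one
    message. *)
Lemma sum_decoded n M (enc : 'I_M -> bits n) (dec : bits n -> 'I_M) :
  \sum_m \sum_(e : bits n) (dec (bxor (enc m) e) == m)%:R = 2 ^+ n :> R.
Proof.
under eq_bigr => m _ do rewrite -(reindex_bxor _ (fun y => (dec y == m)%:R)).
rewrite exchange_big /=; transitivity (\sum_(y : bits n) 1 : R).
  apply: eq_bigr => y _; rewrite (bigD1 (dec y)) //= eqxx big1 ?addr0 //.
  by move=> m; rewrite eq_sym => /negbTE->.
by rewrite sumr_const card_bits natrX.
Qed.

Lemma correct_prob_upper p n M t (enc : 'I_M -> bits n) (dec : bits n -> 'I_M) :
  0 <= p <= 1 -> (0 < n)%N -> (0 < M)%N -> 0 < t ->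
  correct_prob p enc dec <=
  2 ^+ n / M%:R * expR (- (n%:R * (ln 2 * Hb p - t))) + info_var p / (n%:R * t ^+ 2).
Proof.
move=> hp n0 M0 t0; have M0' : 0 < M%:R :> R by rewrite ltr0n.
set E := expR _; set V := _ / (n%:R * _).
pose atyp (e : bits n) := n%:R * t < `|info p e - n%:R * (ln 2 * Hb p)|.
(* Typical noise has weight at most E and is charged to the count of decoded words; atypical noise
   is charged to its own weight. *)
have bound m (e : bits n) :
    bsc_weight p e * (dec (bxor (enc m) e) == m)%:R <=
    E * (dec (bxor (enc m) e) == m)%:R + bsc_weight p e * (atyp e)%:R.
  have w0 := bsc_weight_ge0 e hp; have E0 : 0 <= E by exact: expR_ge0.
  case: (_ == m); last by rewrite !mulr0 add0r mulr_ge0.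
  rewrite !mulr1; case: (boolP (atyp e)) => [_|]; first by rewrite mulr1 lerDr.
  rewrite mulr0 addr0 /atyp -leNgt ler_norml => /andP[typ _].
  apply: (le_trans (bsc_weight_le_info e hp)); rewrite ler_expR lerN2 mulrBr; lra.
rewrite /correct_prob ler_pdivrMl //.
have -> : M%:R * (2 ^+ n / M%:R * E + V) = E * 2 ^+ n + \sum_(m < M) V.
  by rewrite sumr_const card_ord -mulr_natl; field; lra.
rewrite -(sum_decoded enc dec) big_distrr -big_split /=; apply: ler_sum => m _.
apply: (@le_trans _ _ (\sum_(e : bits n) (E * (dec (bxor (enc m) e) == m)%:R +
   bsc_weight p e * (atyp e)%:R))); first by apply: ler_sum.
by rewrite big_split /= -big_distrr lerD2l info_chebyshev.
Qed.

(** * Random coding *)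

(** The witness [i0] excludes the empty type, where the inequality on the sum would hold
    trivially. *)
Lemma exists_le_mean (I : finType) (i0 : I) (F : I -> R) (c : R) :
  \sum_i F i <= #|I|%:R * c -> exists i, F i <= c.
Proof.
move=> leF; apply/existsP; apply: contraLR leF; rewrite negb_exists -ltNge.
move=> /forallP gtF; rewrite mulr_natl -sumr_const; apply: ltr_sum.
  by apply/hasP; exists i0; rewrite ?mem_index_enum.
by move=> i _; rewrite ltNge gtF.
Qed.

(* Translating one codeword by every word z leaves the sum over codebooks
   unchanged, so two distinct codewords are pairwise uniform. *)
Lemma sum_codebooks_pair n M (G : bits n -> R) (m m' : 'I_M) : m' != m ->
  2 ^+ n * \sum_(c : {ffun 'I_M -> bits n}) G (bxor (c m') (c m)) =
  #|{: {ffun 'I_M -> bits n}}|%:R * \sum_x G x.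
Proof.
move=> neq.
transitivity (\sum_(c : {ffun 'I_M -> bits n}) \sum_(z : bits n)
   G (bxor z (bxor (c m') (c m)))).
  rewrite exchange_big /= -natrX -card_bits mulr_natl -sumr_const.
  apply: eq_bigr => z _.
  pose h (c : {ffun 'I_M -> bits n}) : {ffun 'I_M -> bits n} :=
    [ffun k => if k == m' then bxor z (c k) else c k].
  have hK : involutive h.
    by move=> c; apply/ffunP => k; rewrite !ffunE; case: eqP => // _; rewrite bxorKl.
  rewrite (reindex_inj (inv_inj hK)); apply: eq_bigr => c _.
  by rewrite !ffunE eqxx eq_sym (negbTE neq) bxorA.
rewrite mulr_natl -sumr_const; apply: eq_bigr => c _.
under eq_bigr => z _ do rewrite bxorC.
by rewrite -reindex_bxor.
Qed.

(** Some codebook does at least as well as the average over all codebooks, which is computed pair by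
    pair. *)
Lemma exists_spread_codebook n M (G : bits n -> R) : (forall x, 0 <= G x) ->
  exists c : {ffun 'I_M -> bits n},
    \sum_m \sum_(m' | m' != m) G (bxor (c m') (c m)) <=
    M%:R * (M%:R * (\sum_x G x) / 2 ^+ n).
Proof.
move=> G0; have n2 : 0 < 2 ^+ n :> R by rewrite exprn_gt0.
apply: exists_le_mean; first exact: [ffun=> [ffun=> false]].
rewrite -(ler_pM2l n2) exchange_big /= big_distrr /=.
set K := #|_|%:R; set S := \sum_x G x.
have K0 : 0 <= K by []; have S0 : 0 <= S by apply: sumr_ge0.
have -> : 2 ^+ n * (K * (M%:R * (M%:R * S / 2 ^+ n))) = \sum_(m < M) (M%:R * (K * S)).
  by rewrite sumr_const card_ord -mulr_natl; field; rewrite mulr1 gt_eqF.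
apply: ler_sum => m _; rewrite exchange_big /= big_distrr /=.
under eq_bigr => m' neq do rewrite sum_codebooks_pair //.
have -> : M%:R * (K * S) = \sum_(m' < M) K * S.
  by rewrite sumr_const card_ord mulr_natl.
(* The M - 1 competitors of m are rounded up to M by adding the nonnegative diagonal term. *)
rewrite [leRHS](bigID (fun m' => m' != m)) /=.
by rewrite lerDl; apply: sumr_ge0 => ? _; rewrite mulr_ge0.
Qed.

Lemma exists_good_code p n M t : 0 <= p <= 1 -> (0 < n)%N -> (0 < M)%N -> 0 < t ->
  exists (enc : 'I_M -> bits n) (dec : bits n -> 'I_M),
    1 - (M%:R / 2 ^+ n * expR (n%:R * (ln 2 * Hb p + t)) +
         info_var p / (n%:R * t ^+ 2)) <= correct_prob p enc dec.
Proof.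
move=> hp n0 M0 t0; have M0' : 0 < M%:R :> R by rewrite ltr0n.
set E := expR _; set V := _ / (n%:R * _).
have E0 : 0 < E by exact: expR_gt0.
(* Typicality as a weight threshold: since the weights sum to 1, at most E words pass it. *)
pose T (e : bits n) := E^-1 <= bsc_weight p e.
have cardT : \sum_e (T e)%:R <= E.
  rewrite -[leRHS]mulr1 -(ler_pdivrMl _ _ E0) -[leRHS](sum_bsc_weight p n) big_distrr /=.
  apply: ler_sum => e _; case: (boolP (T e)) => [?|_] /=; first by rewrite mulr1.
  by rewrite mulr0 bsc_weight_ge0.
have probT : \sum_e bsc_weight p e * (~~ T e)%:R <= V.
  apply: le_trans (info_chebyshev hp n0 t0); apply: ler_sum => e _.
  have w0 := bsc_weight_ge0 e hp.
  (* Words of weight 0 contribute nothing; any other word outside T has information above n (h + t),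
     with h = [ln 2 * Hb p], so it is atypical. *)
  have [->|wN0] := eqVneq (bsc_weight p e) 0; first by rewrite !mul0r.
  rewrite ler_wpM2l // ler_nat; case: (boolP (T e)) => //= notT.
  suff -> : n%:R * t < `|info p e - n%:R * (ln 2 * Hb p)| by [].
  move: notT; rewrite /T -ltNge (bsc_weight_info hp wN0) -expRN ltr_expR => lt_info.
  by rewrite ltr_normr; apply/orP; left; lra.
(* At x = [bxor (c m') (c m)] this is the probability that m' looks plausible when m is sent. *)
pose G x := \sum_e bsc_weight p e * (T (bxor x e))%:R.
have G0 x : 0 <= G x by apply: sumr_ge0 => e _; rewrite mulr_ge0 ?bsc_weight_ge0.
have sumG : \sum_x G x <= E.
  rewrite exchange_big /=; apply: le_trans cardT.
  rewrite -[leRHS]mul1r -[X in _ <= X * _](sum_bsc_weight p n) big_distrl /=.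
  apply: ler_sum => e _; rewrite -big_distrr /=.
  under eq_bigr => x _ do rewrite bxorC.
  by rewrite -(reindex_bxor e (fun x => (T x)%:R)).
have [c Hc] := exists_spread_codebook M G0.
pose m0 : 'I_M := Ordinal M0.
pose dec y := odflt m0 [pick m | T (bxor (c m) y)].
exists c, dec.
(* Union bound for each noise word: the left side is at most 0 unless the noise is in T and no
   competitor is plausible, and then [pick] can only return m. The default [m0] is thus harmless. *)
have decP m e : 1 - (~~ T e)%:R - \sum_(m' | m' != m) (T (bxor (c m') (bxor (c m) e)))%:R <=
    (dec (bxor (c m) e) == m)%:R :> R.
  have sum0 : 0 <= \sum_(m' | m' != m) (T (bxor (c m') (bxor (c m) e)))%:R :> R.
    by apply: sumr_ge0.
  case: (boolP (T e)) => [Te|_] /=; last first.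
    by rewrite subrr sub0r (le_trans _ (ler0n _ _)) // oppr_le0.
  rewrite subr0; case: (boolP [exists m', (m' != m) && T (bxor (c m') (bxor (c m) e))]).
    move=> /existsP[m' /andP[neq Tm']].
    rewrite (le_trans _ (ler0n _ _)) // subr_le0 (bigD1 m') //= Tm' lerDl.
    by apply: sumr_ge0.
  move=> /existsPn only_m.
  suff -> : dec (bxor (c m) e) = m by rewrite eqxx gerBl.
  rewrite /dec; case: pickP => [m' Tm'|/(_ m)]; last by rewrite bxorKl Te.
  by have := only_m m'; rewrite Tm' andbT negbK => /eqP.
rewrite /correct_prob ler_pdivlMl //.
apply: (@le_trans _ _ (\sum_(m < M)
   (1 - V - \sum_(m' | m' != m) G (bxor (c m') (c m))))).
  rewrite sumrB sumr_const card_ord -mulr_natl.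
  suff : M%:R * (M%:R * (\sum_x G x) / 2 ^+ n) <= M%:R * (M%:R / 2 ^+ n * E).
    by move: Hc; lra.
  by rewrite ler_pM2l // mulrAC ler_wpM2l // mulr_ge0 ?invr_ge0 ?exprn_ge0.
apply: ler_sum => m _.
apply: (@le_trans _ _ (\sum_(e : bits n) bsc_weight p e * (1 - (~~ T e)%:R -
    \sum_(m' | m' != m) (T (bxor (c m') (bxor (c m) e)))%:R))); last first.
  by apply: ler_sum => e _; rewrite ler_wpM2l ?bsc_weight_ge0.
under [leRHS]eq_bigr => e _ do rewrite mulrBr mulrBr mulr1.
rewrite sumrB sumrB sum_bsc_weight.
under [X in _ <= _ - X]eq_bigr => e _ do rewrite big_distrr /=.
rewrite [X in _ <= _ - X]exchange_big /=.
under [X in _ <= _ - X]eq_bigr => m' _ do under eq_bigr => e _ do rewrite bxorA.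
by rewrite lerD2r lerD2l lerN2.
Qed.

End BSC.

(** * Asymptotics and the coding theorem for one BSC *)

Section Region.
Variable R : realType.
Implicit Types (p q t eps r : R) (n M : nat).

Lemma eventually_ge (x t : R) : 0 < t ->
  exists N : nat, forall n, (N <= n)%N -> x <= n%:R * t.
Proof.
move=> t0; exists (Num.truncn (x / t)).+1 => n leNn.
rewrite -ler_pdivrMr //; apply: ltW; apply: (lt_le_trans (truncnS_gt _)).
by rewrite ler_nat.
Qed.

(** The common error term of converse and achievability; the factor 2 pays for rounding the number
    of messages. *)
Lemma eventually_small eps t v : 0 < eps -> 0 < t -> 0 <= v ->
  exists N : nat, forall n, (N <= n)%N ->
    (0 < n)%N /\ 2 * expR (- (n%:R * t)) + v / (n%:R * t ^+ 2) <= eps.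
Proof.
move=> eps0 t0 v0.
(* Since exp(n t) >= 1 + n t >= 4 / eps, the first summand is at most eps / 2; [N2] gives the other
   half. *)
have [N1 HN1] := eventually_ge (4 / eps) t0.
have t2 : 0 < t ^+ 2 by rewrite exprn_gt0.
have [N2 HN2] := eventually_ge (2 * v / eps) t2.
exists (maxn N1 N2).+1 => n leNn; have n0 : (0 < n)%N by apply: leq_trans leNn.
split=> //; have n0' : 0 < n%:R :> R by rewrite ltr0n.
have [le1 le2] : (N1 <= n)%N /\ (N2 <= n)%N.
  by move: (ltnW leNn); rewrite geq_max => /andP.
have nt : 0 < n%:R * t by rewrite mulr_gt0.
have nt2 : 0 < n%:R * t ^+ 2 by rewrite mulr_gt0.
have small1 : expR (- (n%:R * t)) <= eps / 4.
  rewrite expRN -[leRHS]invrK lef_pV2 ?posrE ?expR_gt0 ?invr_gt0 ?divr_gt0 //.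
  rewrite invf_div; apply: (le_trans (HN1 n le1)).
  by apply: le_trans (expR_ge1Dx _); rewrite lerDr.
have small2 : v / (n%:R * t ^+ 2) <= eps / 2.
  rewrite ler_pdivrMr //; have := HN2 n le2; rewrite ler_pdivrMr //; lra.
lra.
Qed.

Lemma powR2E (x : R) : powR 2 x = expR (x * ln 2).
Proof. by rewrite /powR pnatr_eq0. Qed.

Lemma exp2nE n : 2 ^+ n = expR (n%:R * ln 2) :> R.
Proof. by rewrite expRM_natl lnK // posrE ltr0n. Qed.

Lemma num_msgs_le n r : (num_msgs n r)%:R <= expR (n%:R * r * ln 2).
Proof. by rewrite -powR2E; rewrite /num_msgs truncn_le powR_ge0. Qed.

Lemma num_msgs_gt0 n r : 0 <= r -> (0 < num_msgs n r)%N.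
Proof.
move=> r0; rewrite /num_msgs truncn_gt0 powR2E -[leLHS]expR0 ler_expR.
by rewrite !mulr_ge0 // ltW // ln2_gt0.
Qed.

(** With M >= 1 the integer part, x < M + 1 <= 2 M. *)
Lemma num_msgs_ge n r : 0 <= r -> expR (n%:R * r * ln 2) <= 2 * (num_msgs n r)%:R.
Proof.
move=> r0; have := num_msgs_gt0 n r0; rewrite -(ler_nat R) => M1.
have : expR (n%:R * r * ln 2) < (num_msgs n r).+1%:R.
  by rewrite -powR2E truncnS_gt.
by rewrite -addn1 natrD; lra.
Qed.

Lemma num_msgs0 n : num_msgs n (0 : R) = 1%N.
Proof. by rewrite /num_msgs mulr0 powRr0 truncn1. Qed.

Lemma strong_converse p r : 0 <= p <= 1 -> 0 <= r -> bsc_capacity p < r ->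
  forall eps, 0 < eps -> exists N : nat, forall n, (N <= n)%N ->
  forall (enc : 'I_(num_msgs n r) -> bits n) dec, correct_prob p enc dec <= eps.
Proof.
move=> hp r0 Cr eps eps0; have l2 := ln2_gt0 R.
(* Half the gap to capacity, in nats: one half is spent on typicality, the other remains as the
   exponent -n t. *)
pose t := ln 2 * (r - bsc_capacity p) / 2.
have t0 : 0 < t by rewrite divr_gt0 // mulr_gt0 // subr_gt0.
have [N HN] := eventually_small eps0 t0 (info_var_ge0 hp).
exists N => n /HN[n0 small] enc dec.
have M0 := num_msgs_gt0 n r0; have M0' : 0 < (num_msgs n r)%:R :> R by rewrite ltr0n.
apply: le_trans (correct_prob_upper enc dec hp n0 M0 t0) _.
apply: le_trans small; rewrite lerD2r mulrAC ler_pdivrMr // exp2nE -expRD.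
have -> : n%:R * ln 2 + - (n%:R * (ln 2 * Hb p - t)) =
  - (n%:R * t) + n%:R * r * ln 2 by rewrite /t /bsc_capacity; field.
rewrite expRD [leRHS]mulrAC mulrC ler_pM2r ?expR_gt0 //.
exact: num_msgs_ge.
Qed.

(** Rate 0 means a single message, decoded without error; this case keeps the statement useful when
    the capacity is 0. *)
Lemma channel_coding p r : 0 <= p <= 1 -> 0 <= r -> r = 0 \/ r < bsc_capacity p ->
  forall eps, 0 < eps -> exists N : nat, forall n, (N <= n)%N ->
  exists (enc : 'I_(num_msgs n r) -> bits n) dec, 1 - eps <= correct_prob p enc dec.
Proof.
move=> hp r0 [->|rC] eps eps0.
  exists 0%N => n _; rewrite num_msgs0.
  exists (fun=> [ffun=> false]), (fun=> ord0).
  rewrite /correct_prob big_ord1 invr1 mul1r.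
  under eq_bigr => e _ do rewrite mulr1.
  by rewrite sum_bsc_weight gerBl ltW.
have l2 := ln2_gt0 R.
pose t := ln 2 * (bsc_capacity p - r) / 2.
have t0 : 0 < t by rewrite divr_gt0 // mulr_gt0 // subr_gt0.
have [N HN] := eventually_small eps0 t0 (info_var_ge0 hp).
exists N => n /HN[n0 small].
have [enc [dec good]] := exists_good_code hp n0 (num_msgs_gt0 n r0) t0.
exists enc, dec; apply: le_trans good; rewrite lerD2l lerN2.
apply: le_trans small; rewrite lerD2r exp2nE.
apply: (@le_trans _ _ (expR (- (n%:R * t)))); last first.
  by rewrite ler_peMl ?expR_ge0 // ler1n.
rewrite mulrAC ler_pdivrMr ?expR_gt0 // -expRD.
have -> : - (n%:R * t) + n%:R * ln 2 = n%:R * r * ln 2 + n%:R * (ln 2 * Hb p + t).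
  by rewrite /t /bsc_capacity; field.
by rewrite expRD ler_pM2r ?expR_gt0 // num_msgs_le.
Qed.

(** * Achievability and converse for the serial strategy *)

Lemma serial_achievable_direct p13 p14 p23 p34 (RA RB : R) :
  0 <= p13 <= 1 -> 0 <= p14 <= 1 -> 0 <= p23 <= 1 -> 0 <= p34 <= 1 ->
  0 <= RA -> 0 <= RB ->
  RA = 0 \/ RA < bsc_capacity p14 ->
  RB = 0 \/ RB < bsc_capacity (p_eff p13 p23 p34) ->
  serial_achievable p13 p14 p23 p34 RA RB.
Proof.
move=> h13 h14 h23 h34 RA0 RB0 rateA rateB; split=> //; split=> // eps eps0.
have hp := p_eff_itv h13 h23 h34.
have eps2 : 0 < eps / 2 by rewrite divr_gt0.
have [NA HA] := channel_coding h14 RA0 rateA eps2.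
have [NB HB] := channel_coding hp RB0 rateB eps2.
exists (maxn NA NB) => n; rewrite geq_max => /andP[/HA[encA [decA gA]] /HB[encB [decB gB]]].
exists encA, encB, decA, decB; rewrite serial_errorE ?num_msgs_gt0 //.
(* For success probabilities x, y <= 1, (1 - x)(1 - y) >= 0 gives x y >= x + y - 1 >= 1 - eps. *)
have := correct_prob_le1 encA decA h14; have := correct_prob_le1 encB decB hp.
by move: gA gB; nra.
Qed.

Lemma serial_achievable_converse p13 p14 p23 p34 (RA RB : R) :
  0 <= p13 <= 1 -> 0 <= p14 <= 1 -> 0 <= p23 <= 1 -> 0 <= p34 <= 1 ->
  serial_achievable p13 p14 p23 p34 RA RB ->
  RA <= bsc_capacity p14 /\ RB <= bsc_capacity (p_eff p13 p23 p34).
Proof.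
move=> h13 h14 h23 h34 [RA0 [RB0 ach]].
have hp := p_eff_itv h13 h23 h34.
(* Error at most 1/4 makes the product of success probabilities at least 3/4, impossible if one
   factor is at most 1/4 and the other at most 1. *)
have half : 0 < 1 / 4 :> R by lra.
have [N HN] := ach _ half.
suff [? ?] : ~ bsc_capacity p14 < RA /\ ~ bsc_capacity (p_eff p13 p23 p34) < RB.
  by split; rewrite leNgt; apply/negP.
split=> rate.
- have [N' HN'] := strong_converse h14 RA0 rate half.
  have [encA [encB [decA [decB]]]] := HN _ (leq_maxl N N').
  rewrite serial_errorE ?num_msgs_gt0 //.
  have := HN' _ (leq_maxr N N') encA decA.
  have := correct_prob_le1 encB decB hp; have := correct_prob_ge0 encB decB hp.
  have := correct_prob_ge0 encA decA h14; nra.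
- have [N' HN'] := strong_converse hp RB0 rate half.
  have [encA [encB [decA [decB]]]] := HN _ (leq_maxl N N').
  rewrite serial_errorE ?num_msgs_gt0 //.
  have := HN' _ (leq_maxr N N') encB decB.
  have := correct_prob_le1 encA decA h14; have := correct_prob_ge0 encA decA h14.
  have := correct_prob_ge0 encB decB hp; nra.
Qed.

(** * Convex hull and closure of the rate region *)

Lemma conv_hull_box (a b : R) (z : R * R) :
  conv_hull (fun r : R * R => 0 <= r.1 /\ 0 <= r.2 /\ r.1 <= a /\ r.2 <= b) z <->
  0 <= z.1 /\ 0 <= z.2 /\ z.1 <= a /\ z.2 <= b.
Proof.
split=> [[k [w [x [w0 [w1 [Sx ->]]]]]] /=|Sz].
  have mean_le (f : 'I_k -> R) c : (forall i, f i <= c) -> \sum_i w i * f i <= c.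
    move=> fc; rewrite -[leRHS]mul1r -w1 big_distrl; apply: ler_sum => i _.
    by rewrite ler_wpM2l.
  split; first by apply: sumr_ge0 => i _; rewrite mulr_ge0 //; case: (Sx i).
  split; first by apply: sumr_ge0 => i _; rewrite mulr_ge0 //; case: (Sx i) => _ [].
  by split; apply: mean_le => i; case: (Sx i) => _ [_ []].
exists 1%N, (fun=> 1), (fun=> z); rewrite !big_ord1 !mul1r -surjective_pairing.
by do !split; case: Sz => ? [? []].
Qed.

(** Coding reaches only rates 0 or strictly below capacity, so a boundary rate is approached by
    stepping back delta / 2, or by 0 if x is smaller than that step. *)
Lemma approx_rate (x C delta : R) : 0 <= x -> x <= C -> 0 < delta ->
  exists r, [/\ 0 <= r, r = 0 \/ r < C & `|r - x| < delta].
Proof.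
move=> x0 xC d0; have [xd|dx] := lerP x (delta / 2).
  exists 0; split; [by [] | by left | rewrite sub0r normrN ger0_norm //; lra].
exists (x - delta / 2); split; [lra | right; lra |].
by rewrite addrAC subrr add0r normrN ger0_norm; lra.
Qed.

End Region.

Theorem theorem2 (R : realType) (p13 p14 p23 p34 : R)
  (h13 : 0 <= p13 <= 1) (h14 : 0 <= p14 <= 1)
  (h23 : 0 <= p23 <= 1) (h34 : 0 <= p34 <= 1) (RA RB : R) :
  serial_region p13 p14 p23 p34 (RA, RB) <->
  conv_hull (fun r : R * R => 0 <= r.1 /\ 0 <= r.2 /\
                r.1 <= bsc_capacity p14 /\
                r.2 <= bsc_capacity (p_eff p13 p23 p34)) (RA, RB).
Proof.
rewrite conv_hull_box /=; split=> [region|[RA0 [RB0 [RAC RBC]]] delta delta0].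
  (* A limit of achievable pairs satisfies the box constraints up to every delta > 0, hence
     exactly. *)
  have near delta : 0 < delta -> [/\ - delta <= RA, - delta <= RB,
      RA <= bsc_capacity p14 + delta & RB <= bsc_capacity (p_eff p13 p23 p34) + delta].
    move=> /region[rA [rB [ach [/= dA dB]]]].
    have [rAC rBC] := serial_achievable_converse h13 h14 h23 h34 ach.
    case: ach => rA0 [rB0 _].
    by move: dA dB; rewrite !ltr_distl => /andP[? ?] /andP[? ?]; split; lra.
  do !split; apply/ler_addgt0Pr => delta /near[]; lra.
have [rA [rA0 rateA dA]] := approx_rate RA0 RAC delta0.
have [rB [rB0 rateB dB]] := approx_rate RB0 RBC delta0.
by exists rA, rB; split=> //; exact: serial_achievable_direct.
Qed.
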